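(* Let $n\in\mathbb{P}$, $m:=\lfloor n/2\rfloor$, $I\subseteq[n-1]$, let $I_1,\ldots,I_s$ be the connected components of $I$, and let $\widetilde m:=\sum_{k=1}^{s}\left\lfloor\frac{|I_k|+1}{2}\right\rfloor$. If $n=2m+1$ then $$\sum_{\sigma\in C^{I}_{2m+1}}(-1)^{\ell(\sigma)}\chi(\sigma)x^{L(\sigma)}=\left[\begin{array}{c}\widetilde m\\ \left\lfloor\frac{|I_1|+1}{2}\right\rfloor,\ldots,\left\lfloor\frac{|I_s|+1}{2}\right\rfloor\end{array}\right]_{x^2}\prod_{k=\widetilde m+1}^{m}(1-x^{2k}).$$ If $n=2m$ then $$\sum_{\sigma\in C^{I}_{2m}}(-1)^{\ell(\sigma)}\chi(\sigma)x^{L(\sigma)}=\left\{\begin{array}{ll}\left[\begin{array}{c}\widetilde m\\ \left\lfloor\frac{|I_1|+1}{2}\right\rfloor,\ldots,\left\lfloor\frac{|I_s|+1}{2}\right\rfloor\end{array}\right]_{x^2}, & \mbox{if } m=\widetilde m,\\[2mm] (1+x^m)\left[\begin{array}{c}\widetilde m\\ \left\lfloor\frac{|I_1|+1}{2}\right\rfloor,\ldots,\left\lfloor\frac{|I_s|+1}{2}\right\rfloor\end{array}\right]_{x^2}\prod_{k=\widetilde m+1}^{m-1}(1-x^{2k}), & \mbox{otherwise.}\end{array}\right.$$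
   Context: Here $\mathbb{P}=\{1,2,\ldots\}$, $[n]=\{1,\ldots,n\}$, and $x$ is an indeterminate. $S_n$ is the group of permutations of $[n]$. For $\sigma\in S_n$, $\ell(\sigma)=|\{(i,j)\in[n]^2: i<j,\ \sigma(i)>\sigma(j)\}|$ is the Coxeter length and $L(\sigma)=|\{(i,j)\in[n]^2: i<j,\ \sigma(i)>\sigma(j),\ i\not\equiv j \pmod 2\}|$ is the odd length. For $I\subseteq[n-1]$ the quotient is $S_n^I=\{\sigma\in S_n:\sigma(i)<\sigma(i+1)\text{ for all } i\in I\}$ (the index $i$ is identified with the generator $s_i=(i,i+1)$), and $X^I:=X\cap S_n^I$ for $X\subseteq S_n$. Chessboard elements: $C_{n,+}=\{\sigma\in S_n: i+\sigma(i)\equiv 0\pmod 2,\ i=1,\ldots,n\}$, $C_{n,-}=\{\sigma\in S_n: i+\sigma(i)\equiv 1\pmod 2,\ i=1,\ldots,n\}$, $C_n=C_{n,+}\cup C_{n,-}$. The character $\chi:C_n\to\{\pm1\}$ is $\chi(\sigma)=1$ for $\sigma\in C_{n,+}$ and $\chi(\sigma)=-1$ for $\sigma\in C_{n,-}$ (for $n$ odd $C_{n,-}=\emptyset$ and $\chi$ is trivial). The connected components of $I$ are the intervals of integers $[a_1,b_1],\ldots,[a_s,b_s]$ with $I=[a_1,b_1]\cup\cdots\cup[a_s,b_s]$, $a_i\le b_i$, and $a_{i+1}-b_i>1$ (so $s=0$ if $I=\emptyset$). For $n_1+\cdots+n_k=N$ the $q$-multinomial coefficient is $\left[\begin{array}{c}N\\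 n_1,\ldots,n_k\end{array}\right]_q=\frac{[N]_q!}{[n_1]_q!\cdots[n_k]_q!}$, with $[r]_q=\frac{1-q^r}{1-q}$, $[r]_q!=\prod_{i=1}^r[i]_q$, $[0]_q!=1$ (it equals $1$ when $N=0$, $k=0$). Empty products equal $1$. *)

(* Defs.v *)
From mathcomp Require Import all_boot all_order all_fingroup all_algebra.

Set Implicit Arguments.
Unset Strict Implicit.
Unset Printing Implicit Defensive.

Import GRing.Theory.
Local Open Scope ring_scope.

(* The set [n] = {1, ..., n} is represented by 'I_n = {0, ..., n-1}, the
   integer k being encoded by k-1.  Comparisons, the parity of i + s i, and
   congruences between positions are invariant under this shift. *)

Definition ell n (s : 'S_n) : nat :=
  #|[set p : 'I_n * 'I_n | (p.1 < p.2)%N && (s p.2 < s p.1)%N]|.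

Definition odd_length n (s : 'S_n) : nat :=
  #|[set p : 'I_n * 'I_n | [&& (p.1 < p.2)%N, (s p.2 < s p.1)%N
                             & p.1 != p.2 %[mod 2]]]|.

(* The element i : 'I_n.-1 stands for the integer i+1 of [n-1], that is, for
   the transposition of the positions i and i+1 of 'I_n. *)
Definition quotient_set n (I : {set 'I_n.-1}) : {set 'S_n} :=
  [set s : 'S_n | [forall i in I, forall a : 'I_n, forall b : 'I_n,
     (a == i :> nat) && (b == i.+1 :> nat) ==> (s a < s b)%N]].

Definition chessboard_even n : {set 'S_n} :=
  [set s : 'S_n | [forall i : 'I_n, (i + s i == 0 %[mod 2])%N]].

Definition chessboard_odd n : {set 'S_n} :=
  [set s : 'S_n | [forall i : 'I_n, (i + s i == 1 %[mod 2])%N]].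

Definition chessboard n : {set 'S_n} := chessboard_even n :|: chessboard_odd n.

(* Only meaningful on [chessboard n]. *)
Definition chi n (s : 'S_n) : int := if s \in chessboard_even n then 1 else -1.

(* [cs] lists the connected components of I in increasing order; the pair
   (a, b) is the interval [a, b] of 0-based indices, i.e. [a+1, b+1] in [n-1]. *)
Definition connected_components n (I : {set 'I_n.-1}) (cs : seq (nat * nat)) :=
  [/\ forall k : nat, (exists2 i : 'I_n.-1, i \in I & k = i)
                      <-> (exists2 c, c \in cs & (c.1 <= k <= c.2)%N),
      forall c, c \in cs -> (c.1 <= c.2)%N
    & sorted (fun c d : nat * nat => (c.2.+1 < d.1)%N) cs].

Definition interval_card (c : nat * nat) : nat := (c.2 - c.1).+1.

Lemma connected_components_exist n (I : {set 'I_n.-1}) :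
  exists cs, connected_components I cs.
Proof.
pose P (k : nat) := [exists i in I, k == i :> nat].
have PE (k : nat) : reflect (exists2 i : 'I_n.-1, i \in I & k = i) (P k).
  apply: (iffP exists_inP) => -[i Ii]; first by move/eqP->; exists i.
  by move=> ->; exists i.
have Pn k : P k -> (k < n)%N.
  by case/PE=> i _ ->; apply: leq_trans (ltn_ord i) (leq_pred n).
pose mem k (c : nat * nat) := (c.1 <= k <= c.2)%N.
suff /(_ n (leqnn n)) [cs [cs1 cs2 cs3 _]] : forall j, (j <= n)%N ->
  exists cs : seq (nat * nat),
   [/\ forall k, has (mem k) cs = P k && (n - j <= k)%N,
       all (fun c => c.1 <= c.2)%N cs,
       sorted (fun c d : nat * nat => (c.2.+1 < d.1)%N) cs
     & all (fun c => n - j <= c.1)%N cs].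
  exists cs; split=> // [k|]; last exact/allP.
  have {}cs1 : has (mem k) cs = P k by rewrite cs1 subnn andbT.
  by split=> [/PE|/hasP]; [rewrite -cs1 => /hasP | rewrite cs1 => /PE].
elim=> [|j IH] ltjn.
  exists [::]; split=> // k; rewrite subn0 /=.
  by apply/esym/negP => /andP[/Pn]; rewrite ltnNge => /negP.
have [cs] := IH (ltnW ltjn); set a := (n - j.+1)%N.
have -> : (n - j)%N = a.+1 by rewrite /a subnSK.
move=> [cs1 cs2 cs3 cs4].
have cs4' : all (fun c => a <= c.1)%N cs by apply: sub_all cs4 => c /ltnW.
have Pk k : P k && (a <= k)%N = (P a && (k == a)) || has (mem k) cs.
  by rewrite cs1 leq_eqVlt eq_sym; case: eqVneq => [->|]; rewrite ?ltnn /= ?(andbT, andbF, orbF).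
have [Pa|/negPf nPa] := boolP (P a); last first.
  by exists cs; split=> // k; rewrite Pk nPa.
case: cs => [|[b d] cs] in cs1 cs2 cs3 cs4 cs4' Pk *.
  exists [:: (a, a)]; split=> /= [k|||]; rewrite ?leqnn //.
  by rewrite Pk Pa /mem /= orbF -eqn_leq eq_sym orbF.
move: (cs2) (cs4) (cs4') => /andP[bd cs2'] /andP[ltab _] /andP[_ cs4''].
have {bd ltab} [bd ltab] : (b <= d)%N /\ (a < b)%N by [].
have ad : (a <= d)%N by apply: leq_trans bd; apply: ltnW.
have [eb|neb] := eqVneq b a.+1.
  exists ((a, d) :: cs); split.
  - move=> k; rewrite Pk Pa /= orbA; congr (_ || _); rewrite /mem /= eb.
    by rewrite (leq_eqVlt a) eq_sym; case: eqVneq => //= ->; rewrite ad.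
  - exact/andP.
  - by case: (cs) cs3.
  - by apply/andP; split; rewrite ?leqnn.
exists [:: (a, a), (b, d) & cs]; split=> [k|||].
- by rewrite Pk Pa [RHS]/= [LHS]/= {1}/mem /= -eqn_leq eq_sym.
- by apply/andP; split; rewrite ?leqnn.
- by move: cs3 => /= ->; rewrite andbT ltn_neqAle eq_sym neb.
- by apply/andP; split; rewrite ?leqnn.
Qed.

Section QAnalogues.

Variables (F : fieldType) (q : F).

Definition qint (r : nat) : F := (1 - q ^+ r) / (1 - q).

Definition qfact (r : nat) : F := \prod_(1 <= i < r.+1) qint i.

(* Intended for [N = sumn ns]. *)
Definition qmultinomial (N : nat) (ns : seq nat) : F :=
  qfact N / \prod_(k <- ns) qfact k.

End QAnalogues.

(* The field of rational functions in the indeterminate x over the integers;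
   it receives both the polynomial sums and the q-multinomial quotients. *)
Notation ratfun := {fraction {poly int}}.

Definition x : ratfun := FracField.tofrac 'X.

Definition chessboard_sum n (I : {set 'I_n.-1}) : ratfun :=
  \sum_(s in chessboard n :&: quotient_set I)
    (-1) ^+ ell s * (chi s)%:~R * x ^+ odd_length s.

(* Main.v *)
Require Import Defs.
From mathcomp Require Import all_boot all_order all_fingroup all_algebra.
From mathcomp Require Import zify ring.
Import GRing.Theory.
Local Open Scope ring_scope.

Set Implicit Arguments.
Unset Strict Implicit.
Unset Printing Implicit Defensive.

(* View sigma as the word whose letter i stands at position sigma(i): sigma lies
   in S_n^I when the letters of each block (a connected component [a, b] of I,
   enlarged to [a, b + 1], or a single letter) occur in increasing order, and it
   is a chessboard element when the parities of the letters alternate along the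
   word.  Remove the largest block.  If two neighbours of the remaining word have
   the same parity, they belong to different blocks, and swapping them changes
   the sign but not the odd length; such words cancel.  In the surviving words
   the removed letters occur in adjacent pairs, apart possibly from a run of odd
   length at either end.  An inverted couple of pairs contributes x^2, so the
   words with pairs only give a Gaussian binomial coefficient at x^2, and the
   sums Z+ and Z- over C_{n,+} and C_{n,-} (without chi) are linear combinations
   of those for the smaller word.  With q = x^2, m = n/2 rounded down,
   (q)_r = (1 - q) ... (1 - q^r) and D the product of the (q)_p over the halved
   block sizes p, of sum mt, induction on the number of blocks yields
     D Z+ = (q)_m for n odd,  D (Z+ + x^m Z-) = (q)_m for n even,
   where, for n even, Z- = 0 if m = mt and Z- = - x^m Z+ otherwise. *)

(** * Signed sums over words with prescribed parities *)

Definition alt (c : bool) (j : nat) : bool := odd j (+) c.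

Section WordSum.

Variables (F : fieldType) (y : F) (I : nat -> bool).

(* The sum of (-1)^ell y^(odd length) over the words on the letters 0, ..., n - 1
   in which i precedes i + 1 whenever [I i], the letter at position j has parity
   [e j], and the largest letter stands before position [u].  The index p is the
   position of the largest letter. *)
Fixpoint word_sum n (e : nat -> bool) (u : nat) : F :=
  if n is n'.+1 then
    \sum_(0 <= p < u | (p <= n')%N && (e p == odd n'))
      (-1) ^+ (n' - p) * y ^+ (\sum_(p <= j < n') (e (bump p j) != odd n'))
      * word_sum n' (e \o bump p) (if I n'.-1 then p else n')
  else 1.

Arguments word_sum : simpl never.

(** The letter [n] at position [p] is inverted with the [n - p] letters to its right, and the
    prescribed parities tell which of them count for the odd length. The bound [p] puts the letter
    [n.-1] to its left. *)
Definition word_term n e p : F :=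
  (-1) ^+ (n - p) * y ^+ (\sum_(p <= j < n) (e (bump p j) != odd n))
  * word_sum n (e \o bump p) (if I n.-1 then p else n).

Lemma word_sumS n e u :
  word_sum n.+1 e u
    = \sum_(0 <= p < u | (p <= n)%N && (e p == odd n)) word_term n e p.
Proof. by []. Qed.

Lemma word_sum_boundS n e u :
  word_sum n.+1 e u.+1
    = word_sum n.+1 e u
      + (if (u <= n)%N && (e u == odd n) then word_term n e u else 0).
Proof. by rewrite !word_sumS big_mkcond big_nat_recr //= -big_mkcond. Qed.

Lemma word_sum_skip n e u :
  e u != odd n -> word_sum n.+1 e u.+1 = word_sum n.+1 e u.
Proof. by move=> /negPf Hu; rewrite word_sum_boundS Hu andbF addr0. Qed.

Lemma word_sum_bound0 n e : word_sum n.+1 e 0 = 0.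
Proof. by rewrite word_sumS big_geq. Qed.

Lemma eq_word_sum n e1 e2 u :
  (forall j, (j < n)%N -> e1 j = e2 j) -> word_sum n e1 u = word_sum n e2 u.
Proof.
elim: n e1 e2 u => [//|n IHn] e1 e2 u He; rewrite !word_sumS.
rewrite [LHS]big_seq_cond [RHS]big_seq_cond.
apply: eq_big => [p|p /andP[_ /andP[lepn _]]].
  by case: (leqP p n) => [lepn|]; rewrite ?andbF // He.
have Hb j : (j < n)%N -> e1 (bump p j) = e2 (bump p j).
  by move=> ltjn; apply: He; rewrite /bump; lia.
rewrite /word_term (IHn _ (e2 \o bump p)) //; congr (_ * y ^+ _ * _).
by apply: eq_big_nat => j /andP[_ ltjn]; rewrite Hb.
Qed.

(* The two words exchanged by swapping the letters at the positions i and i+1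
   have the same odd length and opposite signs; the swap respects the order
   inside the blocks, since consecutive letters of a block have distinct
   parities. *)
Lemma word_sum_repeat n e u i :
  (i.+1 < n)%N -> e i = e i.+1 -> u != i.+1 -> word_sum n e u = 0.
Proof.
elim: n e u i => [//|n IHn] e u i ltin ei neu; rewrite word_sumS.
(* If the largest letter is at neither [i] nor [i.+1], its removal keeps the repeat, and induction
   applies. *)
have Hlow p : (p < i)%N -> word_term n e p = 0.
  move=> ltpi; rewrite /word_term (IHn _ _ i.-1) ?mulr0 //=.
  - lia.
  - rewrite prednK ?(leq_ltn_trans _ ltpi) // /bump (ltnW ltpi).
    by rewrite (_ : (p <= i.-1)%N) ?add1n ?prednK ?ei //; lia.
  - by case: ifP => _; lia.
have Hhigh p : (i.+1 < p)%N -> (p <= n)%N -> word_term n e p = 0.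
  move=> ltip lepn; rewrite /word_term (IHn _ _ i) ?mulr0 //=.
  - lia.
  - by rewrite /bump (leqNgt p i) (leqNgt p i.+1) (ltnW ltip) ltip.
  - by case: ifP => _; lia.
case: (leqP u i) => [leui|ltiu].
  apply: big1_seq => p; rewrite mem_index_iota => /andP[_ ltpu].
  by apply: Hlow; lia.
have {neu ltiu} ltiu : (i.+2 <= u)%N by lia.
rewrite (big_cat_nat (n := i)) ?(ltnW (ltnW ltiu)) //=.
rewrite big1_seq => [|p]; last first.
  by rewrite mem_index_iota => /andP[_ ltpu]; apply: Hlow; lia.
rewrite (big_cat_nat (n := i.+2)) ?leqW //= add0r.
rewrite [X in _ + X]big1_seq ?addr0 => [|p]; last first.
  by rewrite mem_index_iota => /andP[/andP[lepn _] ltpu]; apply: Hhigh; lia.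
rewrite big_mkcond big_ltn // big_nat1 -ei.
have -> : (i <= n)%N by lia.
have -> : (i < n)%N by [].
case: eqP => [odd_n /=|_ /=]; last by rewrite addr0.
rewrite /word_term; set e1 := e \o bump i; set e2 := e \o bump i.+1.
have He j : e1 j = e2 j.
  rewrite /e1 /e2 /bump /=; case: (ltngtP i j) => [||<-] //=.
(* The two bounds differ by position [i] of the shorter word, whose parity is that of [n] and so
   unsuitable for the letter [n.-1]. *)
have HZ : word_sum n e1 (if I n.-1 then i else n)
        = word_sum n e2 (if I n.-1 then i.+1 else n).
  rewrite (@eq_word_sum n e1 e2) //; case: (I _) => //.
  case: n {IHn Hlow Hhigh} ltin odd_n => [//|n] ltin odd_n.
  rewrite word_sum_skip // -He /e1 /= /bump leqnn -ei odd_n /=.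
  by case: (odd n).
rewrite HZ (@big_ltn _ _ _ i n) // /=.
have -> : e (bump i i) = odd n by rewrite /bump leqnn -ei.
rewrite eqxx add0n subnS.
have -> : (\sum_(i.+1 <= j < n) (e (bump i j) != odd n)
         = \sum_(i.+1 <= j < n) (e (bump i.+1 j) != odd n))%N.
  by apply: eq_bigr => j _; rewrite -[e (bump i j)]/(e1 j) He.
have -> : (n - i = (n - i).-1.+1)%N by lia.
by rewrite exprS /=; ring.
Qed.

(** The [k] increasing letters from [N] on would all need distinct positions below [u < k]. *)
Lemma word_sum_crowded N k e u :
  (forall j, (N <= j)%N -> (j.+1 < N + k)%N -> I j) -> (u < k)%N ->
  word_sum (N + k) e u = 0.
Proof.
elim: k e u => [//|k IHk] e u HI ltuk; rewrite addnS word_sumS.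
apply: big1_seq => p; rewrite mem_index_iota => /andP[_ ltpu].
rewrite /word_term; case: k => [|k] in IHk HI ltuk *; first by lia.
rewrite HI; try lia.
by rewrite IHk ?mulr0 //; try lia; move=> j ? ?; apply: HI; lia.
Qed.

Lemma alt_bump c p j : alt c (bump p j) = alt (c (+) (p <= j)%N) j.
Proof. by rewrite /alt /bump oddD; case: (p <= j)%N; case: c; case: (odd j). Qed.

Lemma sum_alt p n b :
  (\sum_(p <= j < n) (odd j != b) = (n - p + (odd p != b))./2)%N.
Proof.
case: (leqP p n) => [/subnKC <-|ltnp]; last first.
  by rewrite big_geq ?(ltnW ltnp) // (eqP (ltnW ltnp)); case: (_ != _).
elim: (n - p)%N => [|k IHk]; first by rewrite addn0 big_geq // subnn; case: (_ != _).
rewrite addnS big_nat_recr ?leq_addr //= IHk addKn -addnS addKn oddD.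
by have := odd_double_half k; case: b {IHk}; case: (odd p); case: (odd k) => /=; lia.
Qed.

(** The letter [n] must stand to the left of [n.+1]; unless it is adjacent, a repeat survives and
    the words cancel. Each letter to the right of the resulting pair is inverted with both members
    and differs in parity from exactly one, so the signs cancel and each such letter gives a factor
    [y]. *)
Lemma word_sum_alt_interior n c p :
  (0 < p <= n)%N -> I n -> alt c p = odd n.+1 ->
  word_term n.+1 (alt c) p
    = y ^+ (n.+1 - p) * word_sum n (alt c) (if I n.-1 then p.-1 else n).
Proof.
move=> /andP[p_gt0 lepn] In Hp; rewrite /word_term /= In.
case: p p_gt0 lepn Hp => [//|p] _ ltpn Hp; rewrite word_sum_boundS.
set e := alt c \o bump p.+1.
have -> : word_sum n.+1 e p = 0.
  rewrite word_sumS; apply: big1_seq => p'; rewrite mem_index_iota => /andP[_ ltp'].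
  rewrite /word_term (@word_sum_repeat _ _ _ p.-1) ?mulr0 //; try lia.
    rewrite /e /= /bump; have -> : (p' <= p.-1)%N by lia.
    have -> : (p' <= p.-1.+1)%N by lia.
    rewrite !add1n prednK; last by lia.
    by rewrite ltnn leqnn /alt /= add0n negbK.
  by case: ifP => _; lia.
have ep : e p = odd n.
  by apply: negb_inj; rewrite -[~~ odd n]Hp /e /alt /= /bump ltnn add0n addNb.
rewrite ep eqxx (ltnW ltpn) add0r /word_term /=.
rewrite (@eq_word_sum n (e \o bump p) (alt c)); last first.
  move=> j _; rewrite /e /= !alt_bump /alt; case: (leqP p j) => lepj.
    have -> : (p < bump p j)%N by rewrite /bump lepj.
    by rewrite !addbT negbK.
  have -> : (p < bump p j)%N = false.
    by rewrite /bump (leqNgt p j) lepj ltnNge (ltnW lepj).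
  by rewrite !addbF.
rewrite !mulrA; congr (_ * _).
have -> : (\sum_(p.+1 <= j < n.+1) (alt c (bump p.+1 j) != odd n.+1))%N
        = (\sum_(p.+1 <= j < n.+1) (odd j != c (+) odd n))%N.
  apply: eq_big_nat => j /andP[ltpj _]; rewrite alt_bump ltpj /alt /=.
  by clear -c n j; case: c; case: (odd j); case: (odd n).
have -> : (\sum_(p <= j < n) (e (bump p j) != odd n))%N
        = (\sum_(p <= j < n) (odd j != c (+) odd n))%N.
  apply: eq_big_nat => j /andP[lepj _].
  rewrite /e /= /bump lepj add1n ltnS lepj add1n /alt /=.
  by clear -c n j; case: c; case: (odd j); case: (odd n).
rewrite !sum_alt subSS.
rewrite -mulrA mulrACA -!exprD addnn -mul2n exprM sqrrN !expr1n mul1r.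
by congr (y ^+ _); move: Hp; rewrite /alt /=; clear -ltpn; case: c; lia.
Qed.

(** At an interior position the removed letter leaves a repeat that no order constraint protects, so
    only the two ends survive. *)
Lemma word_sum_single n c u : (0 < n)%N -> ~~ I n.-1 ->
  word_sum n.+1 (alt c) u
    = (if (0 < u)%N && (c == odd n) then word_term n (alt c) 0 else 0)
      + (if (n < u)%N && ~~ c then word_term n (alt c) n else 0).
Proof.
move=> n_gt0 nI; elim: u => [|u IHu]; first by rewrite word_sum_bound0 addr0.
rewrite word_sum_boundS {}IHu.
case: (posnP u) => [->|u_gt0].
  rewrite /= addr0 add0r ltnS leqNgt n_gt0 /= addr0.
  by rewrite /alt; case: c; case: (odd n).
rewrite ltnS -addrA; congr (_ + _); rewrite ltnS.
case: (ltngtP u n) => [ltun|ltun|eun] /=; last first.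
- by rewrite eun /alt add0r; case: c; case: (odd n).
- by rewrite addr0.
rewrite add0r; case: eqP => // _.
rewrite /word_term (negPf nI) (@word_sum_repeat _ _ _ u.-1) ?mulr0 //; try lia.
rewrite /= !alt_bump prednK //; have -> : (u <= u.-1 = false)%N by lia.
by rewrite leqnn -{2}[u](prednK u_gt0) /alt /=; case: c; case: (odd _).
Qed.

Lemma word_term_last n c :
  word_term n (alt c) n = word_sum n (alt c) n.
Proof.
rewrite /word_term subnn big_geq // !mul1r if_same; apply: eq_word_sum => j ltjn.
by rewrite /= /bump leqNgt ltjn.
Qed.

Lemma word_term_first n c : ((0 < n)%N -> ~~ I n.-1) -> c = odd n ->
  word_term n (alt c) 0 = (-1) ^+ n * y ^+ (n.+1)./2 * word_sum n (alt (~~ c)) n.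
Proof.
move=> nI cn; rewrite /word_term subn0; congr (_ * y ^+ _ * _).
  rewrite -[RHS]/(uphalf n) (_ : uphalf n = (n - 0 + (odd 0 != odd n (+) ~~ c))./2)%N.
    by rewrite -sum_alt; apply: eq_bigr => j _; rewrite /alt /bump /=;
       case: c {cn}; case: (odd j); case: (odd n).
  by rewrite cn; clear; lia.
rewrite (@eq_word_sum n _ (alt (~~ c))) => [|j _]; last first.
  by rewrite /alt /=; case: c {cn}; case: (odd j).
by case: n nI {cn} => [//|n] nI; rewrite (negPf (nI _)).
Qed.

End WordSum.
Arguments word_sum : simpl never.

(** * Removing a block from an alternating word *)

Section BlockRecursion.

Variables (F : fieldType) (y : F) (I : nat -> bool).
Hypothesis y_generic : forall k, (0 < k)%N -> 1 - y ^+ (2 * k) != 0.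

(** * Finite q-Pochhammer symbols and Gaussian binomials at q = y^2 *)

Definition qpoch n : F := \prod_(1 <= k < n.+1) (1 - y ^+ (2 * k)).

Lemma qpochS n : qpoch n.+1 = qpoch n * (1 - y ^+ (2 * n.+1)).
Proof. by rewrite /qpoch big_nat_recr. Qed.

Lemma qpoch0 : qpoch 0 = 1.
Proof. by rewrite /qpoch big_geq. Qed.

Lemma qpoch_neq0 n : qpoch n != 0.
Proof.
by elim: n => [|n IHn]; rewrite ?qpoch0 ?oner_eq0 // qpochS mulf_neq0 ?y_generic.
Qed.

(* The Gaussian binomial coefficient [d + b choose b] at y^2. *)
Definition qbin d b : F := qpoch (d + b) / (qpoch d * qpoch b).

Lemma qbin0n b : qbin 0 b = 1.
Proof. by rewrite /qbin add0n qpoch0 mul1r divff ?qpoch_neq0. Qed.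

Lemma qbinn0 d : qbin d 0 = 1.
Proof. by rewrite /qbin addn0 qpoch0 mulr1 divff ?qpoch_neq0. Qed.

(** This and the next lemma are the two q-Pascal rules. *)
Lemma qbinSS d b :
  qbin d.+1 b.+1 = qbin d.+1 b + y ^+ (2 * b.+1) * qbin d b.+1.
Proof.
rewrite /qbin addSn addnS !addSn !qpochS.
have -> : y ^+ (2 * (d + b).+2) = y ^+ (2 * d.+1) * y ^+ (2 * b.+1).
  by rewrite -exprD; congr (y ^+ _); lia.
have ? := y_generic (ltn0Sn d); have ? := y_generic (ltn0Sn b).
have ? := qpoch_neq0 d; have ? := qpoch_neq0 b.
by field; do ?[apply/andP; split].
Qed.

Lemma qbinSS' d b :
  qbin d.+1 b.+1 = y ^+ (2 * d.+1) * qbin d.+1 b + qbin d b.+1.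
Proof.
rewrite /qbin addSn addnS !addSn !qpochS.
have -> : y ^+ (2 * (d + b).+2) = y ^+ (2 * d.+1) * y ^+ (2 * b.+1).
  by rewrite -exprD; congr (y ^+ _); lia.
have ? := y_generic (ltn0Sn d); have ? := y_generic (ltn0Sn b).
have ? := qpoch_neq0 d; have ? := qpoch_neq0 b.
by field; do ?[apply/andP; split].
Qed.

(** * Adding a block that starts at the letter [N] *)

Variable N : nat.
Hypothesis block_start : (0 < N)%N -> ~~ I N.-1.
Definition in_block k := forall j, (N <= j)%N -> (j.+1 < N + k)%N -> I j.

Lemma in_block_leq k k' : (k <= k')%N -> in_block k' -> in_block k.
Proof. by move=> lekk' H j ? ?; apply: H; lia. Qed.

(** The largest letter stands at [p], with its predecessor adjacent to it, or before [p.-1], a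
    position of the wrong parity. For [k = 0] the pair is the whole block and leaves no constraint,
    hence the bound [N]. *)
Lemma word_sum_pair k c p : in_block k.+2 -> (0 < p <= N + k)%N ->
  alt c p = odd (N + k).+1 ->
  word_sum y I (N + k.+2) (alt c) p.+1
    = word_sum y I (N + k.+2) (alt c) p.-1
      + y ^+ (N + k.+1 - p)
        * word_sum y I (N + k) (alt c) (if k == 0%N then N else p.-1).
Proof.
move=> Ik /andP[p_gt0 lep] Hp; rewrite !addnS word_sum_boundS Hp eqxx (leqW lep).
have In : I (N + k) by apply: Ik; lia.
rewrite word_sum_alt_interior ?p_gt0 //.
congr (_ + _ * _).
  rewrite -{1}(prednK p_gt0) word_sum_skip // -Hp -{2}(prednK p_gt0) /alt /=.
  by case: c {Hp}; case: (odd _).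
case: k Ik lep {Hp In} => [|k] Ik lep; last by rewrite Ik //; lia.
rewrite addn0 eqxx; case: N block_start => [//|N'] H.
by rewrite (negPf (H _)).
Qed.

(* The last letters of a block occupy adjacent positions two by two, and a
   pair of letters inverted with a pair of smaller ones contributes y^2.  Thus
   the value is [g], the common value for b = 0, times the sum over the ways of
   interleaving b pairs of the block with the d pairs of smaller letters allowed
   by the position bound. *)
Lemma word_sum_block s h c g b d :
  (h <= s.+1)%N -> odd h = odd N (+) odd s (+) c ->
  (forall d, (2 * d < N + s - h)%N ->
     word_sum y I (N + s) (alt c) (if s == 0%N then N else (2 * d + h)%N) = g) ->
  in_block (s + 2 * b) -> (2 * d < N + s - h)%N ->
  word_sum y I (N + (s + 2 * b)) (alt c)
      (if s + 2 * b == 0 then N else 2 * b + 2 * d + h)%N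
    = y ^+ ((N + s - h - 2 * d) * b) * qbin d b * g.
Proof.
(* Here [s] counts the unpaired letters of the block, and the parity of [h] makes the last position
   below the bound suit the largest letter. The induction follows [qbinSS]: the last pair stands
   there, or [d] drops by one. *)
move=> hs hpar base; elim: b d => [|b IHb] d Ib ltd.
  by rewrite muln0 addn0 qbinn0 muln0 !mul1r; exact: base.
have eqk : (s + 2 * b.+1 = (s + 2 * b).+2)%N by lia.
rewrite eqk /= in Ib *.
have Ib' : in_block (s + 2 * b) by apply: in_block_leq Ib; lia.
elim: d ltd => [|d IHd] ltd.
  have -> : (2 * b.+1 + 2 * 0 + h = (2 * b + h).+2)%N by lia.
  rewrite word_sum_pair //=; last first.
  - by move: hpar; rewrite /alt /=; clear; case: c; lia.
  - lia.
  (* As [h <= s.+1], the lower bound leaves fewer positions than block letters. *)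
  rewrite word_sum_crowded ?add0r //; last lia.
  have := IHb 0%N Ib' ltd; rewrite muln0 addn0 subn0 !qbin0n !mulr1 => ->.
  rewrite mulrA -exprD; congr (y ^+ _ * _).
  by rewrite mulnS; lia.
have -> : (2 * b.+1 + 2 * d.+1 + h = (2 * b + 2 * d + h).+4)%N by lia.
rewrite word_sum_pair //=; last first.
- by move: hpar; rewrite /alt /=; clear; case: c; lia.
- lia.
set K := (N + s - h - 2 * d.+1)%N.
have -> : (N + (s + 2 * b).+1 - (2 * b + 2 * d + h).+3 = K)%N by rewrite /K; lia.
have -> : ((2 * b + 2 * d + h).+2 = 2 * b.+1 + 2 * d + h)%N by lia.
rewrite IHd; last lia.
have -> : (2 * b.+1 + 2 * d + h = 2 * b + 2 * d.+1 + h)%N by lia.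
rewrite IHb // qbinSS.
have -> : (N + s - h - 2 * d = K.+2)%N by rewrite /K; lia.
have -> : y ^+ (K.+2 * b.+1) = y ^+ (K * b) * y ^+ K * y ^+ (2 * b.+1).
  by rewrite -!exprD; congr (y ^+ _); lia.
have -> : y ^+ (K * b.+1) = y ^+ (K * b) * y ^+ K.
  by rewrite -!exprD; congr (y ^+ _); lia.
by ring.
Qed.

Definition plus_sum n := word_sum y I n (alt false) n.

(* Set to 0 when n is odd, as there is no such word, and when n = 0, so that the
   empty word is counted in [plus_sum] only. *)
Definition minus_sum n :=
  if odd n || (n == 0)%N then 0 else word_sum y I n (alt true) n.

Let a := N./2.

(** The bound excludes the last position, so the letter [N] must come first, which requires [N]
    even; for [N] odd both sides are 0. *)
Lemma word_sum_single_pair d : (2 * d < 2 * a)%N ->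
  word_sum y I N.+1 (alt false) (2 * d + (odd N).+1)
    = y ^+ a * minus_sum N.
Proof.
rewrite /a => ltd; have N_gt0 : (0 < N)%N by lia.
rewrite word_sum_single ?block_start // /minus_sum -[N == _]negbK -lt0n N_gt0 orbF.
rewrite (_ : (N < _)%N = false) ?addr0; last lia.
rewrite addn_gt0 orbT /=; case: ifPn => [/eqP oN|]; last first.
  by case: (odd N); rewrite ?mulr0.
rewrite word_term_first // -signr_odd -oN mul1r.
by congr (y ^+ _ * _); lia.
Qed.

Lemma plus_sumS n :
  plus_sum n.+1 = plus_sum n + word_sum y I n.+1 (alt false) n.-1.
Proof.
rewrite /plus_sum word_sum_boundS leqnn /alt addbF eqxx word_term_last addrC.
congr (_ + _); case: n => [//|n].
by rewrite word_sum_skip //= /alt addbF; case: (odd n).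
Qed.

(** In an odd block one letter stays unpaired: the last one at the end of the word, or the first one
    at its front, which costs [y ^+ a] and leaves a word of [minus_sum]. In an even block neither or
    both of these occur. The two lengths are treated alternately, by [plus_sumS]. *)
Lemma plus_sum_block b :
  (in_block (2 * b) ->
     plus_sum (N + 2 * b) = qbin a b * plus_sum N
       + (if b is b'.+1 then y ^+ a * qbin a b' * minus_sum N else 0)) /\
  (in_block (2 * b).+1 ->
     plus_sum (N + (2 * b).+1)
       = qbin a b * (plus_sum N + y ^+ a * minus_sum N)).
Proof.
have even_odd b' : (in_block (2 * b') ->
     plus_sum (N + 2 * b') = qbin a b' * plus_sum N
       + (if b' is b''.+1 then y ^+ a * qbin a b'' * minus_sum N else 0)) ->
   in_block (2 * b').+1 -> plus_sum (N + (2 * b').+1)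
       = qbin a b' * (plus_sum N + y ^+ a * minus_sum N).
  move=> He Ib; rewrite addnS plus_sumS He; last exact: in_block_leq Ib.
  case: (posnP a) => [a0|a_gt0].
    rewrite -addnS word_sum_crowded //; last by move: a0; rewrite /a; lia.
    have -> : minus_sum N = 0.
      by rewrite /minus_sum; case: ifPn => // H; move: a0 H; rewrite /a; lia.
    by rewrite a0 !qbin0n; case: b' {He Ib} => [|?]; ring.
  (* The bound [(N + 2 * b').-1] has the required form with [d = a.-1]. *)
  have /= := @word_sum_block 1 (odd N).+1 false (y ^+ a * minus_sum N) b' a.-1.
  have -> : (2 * b' + 2 * a.-1 + (odd N).+1 = (N + 2 * b').-1)%N.
    by move: a_gt0; rewrite /a; lia.
  have -> : (N + 1 - (odd N).+1 = 2 * a)%N by rewrite /a; lia.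
  rewrite !add1n addn1 addnS => -> //; last first.
  - by rewrite ltn_pmul2l // prednK.
  - by move=> d; apply: word_sum_single_pair.
  - by rewrite /=; case: (odd N).
  - by case: (odd N).
  have -> : (2 * a - 2 * a.-1 = 2)%N by lia.
  case: b' {He Ib} => [|b']; first by rewrite !qbinn0 muln0 !mul1r; ring.
  by have := qbinSS a.-1 b'; rewrite prednK // => ->; ring.
elim: b => [|b [IHe IHo]].
  suff He : in_block (2 * 0) -> plus_sum (N + 2 * 0) = qbin a 0 * plus_sum N + 0.
    by split=> //; apply: even_odd.
  by rewrite muln0 addn0 qbinn0 mul1r addr0.
suff He : in_block (2 * b.+1) -> plus_sum (N + 2 * b.+1)
    = qbin a b.+1 * plus_sum N + y ^+ a * qbin a b * minus_sum N.
  by split=> //; apply: even_odd.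
rewrite mulnS add2n => Ib; rewrite addnS plus_sumS IHo; last exact: in_block_leq Ib.
case: (posnP a) => [a0|a_gt0].
  rewrite -addnS word_sum_crowded //; last by move: a0; rewrite /a; lia.
  by rewrite a0 !qbin0n; ring.
have /= := @word_sum_block 0 (odd N) false (plus_sum N) b.+1 a.-1.
have -> : (2 * b.+1 + 2 * a.-1 + odd N = (N + (2 * b).+1).-1)%N.
  by move: a_gt0; rewrite /a; lia.
rewrite addn0 add0n.
have -> : (N - odd N = 2 * a)%N by rewrite /a; lia.
rewrite mulnS add2n addnS => /= -> //; last first.
- by rewrite ltn_pmul2l // prednK.
- by case: (odd N).
- by case: (odd N).
have -> : (2 * a - 2 * a.-1 = 2)%N by lia.
by have := qbinSS a.-1 b; rewrite prednK // => ->; ring.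
Qed.

Lemma word_sum_alt_true n : ~~ odd n -> (0 < n)%N ->
  word_sum y I n (alt true) n = word_sum y I n (alt true) n.-1.
Proof.
by case: n => [//|n] /= on _; rewrite word_sum_skip // /alt addbT; case: (odd n) on.
Qed.

(** By parity no pair of the block can begin or end the word. So a single smaller letter stands at
    each end, with [a.-1] smaller pairs between, and the final one gives a factor [y] with each of
    the [b.+1] pairs. *)
Lemma minus_sum_block_even b : ~~ odd N -> in_block (2 * b.+1) ->
  minus_sum (N + 2 * b.+1) = y ^+ b.+1 * qbin a.-1 b.+1 * minus_sum N.
Proof.
move=> oN Ib; rewrite /minus_sum.
rewrite (_ : odd _ || _ = false); last lia.
rewrite word_sum_alt_true; try lia.
case: (posnP N) => [N0|N_gt0].
  by rewrite orbT mulr0 word_sum_crowded //; lia.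
rewrite (negPf oN) /=.
have /= := @word_sum_block 0 1 true (word_sum y I N (alt true) N) b.+1 a.-1.
have -> : (2 * b.+1 + 2 * a.-1 + 1 = (N + (2 * b).+2).-1)%N.
  by rewrite /a; lia.
rewrite addn0 add0n (_ : N - 1 - 2 * a.-1 = 1)%N; last by rewrite /a; lia.
have -> : (2 * b.+1 = (2 * b).+2)%N by lia.
rewrite /= mul1n => -> //.
- by move: oN; case: (odd N).
- by move: Ib; have -> : (2 * b.+1 = (2 * b).+2)%N by lia.
- by rewrite /a; lia.
Qed.

(** The first letter of the block goes to the front, giving the sign and [y ^+ a.+1]; each of the
    [b] pairs is inverted with the single smaller letter at the end. *)
Lemma minus_sum_block_odd b : odd N -> in_block (2 * b).+1 ->
  minus_sum (N + (2 * b).+1) = - y ^+ (a + b).+1 * qbin a b * plus_sum N.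
Proof.
move=> oN Ib; rewrite /minus_sum.
rewrite (_ : odd _ || _ = false); last lia.
rewrite word_sum_alt_true; try lia.
have /= := @word_sum_block 1 1 true (- y ^+ a.+1 * plus_sum N) b a.
have -> : (2 * b + 2 * a + 1 = (N + (2 * b).+1).-1)%N by rewrite /a; lia.
rewrite add1n addn1 (_ : N.+1 - 1 - 2 * a = 1)%N; last by rewrite /a; lia.
rewrite /= mul1n => -> //.
- by rewrite -addSn exprD; ring.
- by rewrite oN.
- move=> d ltd; rewrite word_sum_single ?block_start //; last lia.
  rewrite andbF addr0 oN eqxx addn1 /= word_term_first ?oN //.
    rewrite -signr_odd oN expr1 mulN1r; congr (- y ^+ _ * _).
    by rewrite /a; lia.
  by case: N oN.
- by rewrite /a; lia.
Qed.

End BlockRecursion.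

(** * The closed form *)

Section ClosedForm.

Variables (F : fieldType) (y : F) (I : nat -> bool).
Hypothesis y_generic : forall k, (0 < k)%N -> 1 - y ^+ (2 * k) != 0.

(** The invariant of the induction on blocks, freed of denominators by the factor [D]. *)
Definition closed_form n mt (D : F) :=
  [/\ (mt <= n./2)%N,
      odd n -> D * plus_sum y I n = qpoch y n./2
    & ~~ odd n ->
        D * (plus_sum y I n + y ^+ n./2 * minus_sum y I n) = qpoch y n./2
        /\ minus_sum y I n
             = if n./2 == mt then 0 else - y ^+ n./2 * plus_sum y I n].

Lemma qpochD a b : qpoch y (a + b) = qpoch y a * qpoch y b * qbin y a b.
Proof. by rewrite /qbin mulrC divfK // mulf_neq0 ?qpoch_neq0. Qed.

Lemma closed_form_block N k mt D :
  ((0 < N)%N -> ~~ I N.-1) -> in_block I N k ->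
  closed_form N mt D -> closed_form (N + k) (mt + k./2) (D * qpoch y k./2).
Proof.
move=> I_N Ik [le_mt Qodd Qeven].
have [plus_even plus_odd] := plus_sum_block y_generic I_N k./2.
have := odd_double_half k; rewrite -mul2n; case ok: (odd k) => /= ek.
  rewrite add1n in ek; rewrite ek in plus_odd; have {}plus_odd := plus_odd Ik.
  have oNk : odd (N + k) = ~~ odd N by rewrite oddD ok addbT.
  case oN: (odd N) oNk Qodd Qeven => /= oNk Qodd Qeven.
    have half_Nk : ((N + k)./2 = (N./2 + k./2).+1)%N by lia.
    have minus0 : minus_sum y I N = 0 by rewrite /minus_sum oN.
    rewrite minus0 mulr0 addr0 in plus_odd.
    have minus_odd := minus_sum_block_odd y_generic I_N (b := k./2) oN.
    rewrite ek in minus_odd; have {}minus_odd := minus_odd Ik.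
    split; rewrite ?oNk //; first by lia.
    move=> _; rewrite half_Nk minus_odd plus_odd; split; last first.
      by rewrite (_ : (_ == _) = false); [ring | lia].
    rewrite qpochS qpochD -Qodd // mul2n -addnn exprD; ring.
  have [Q1 Q2] := Qeven isT.
  have half_Nk : ((N + k)./2 = N./2 + k./2)%N by lia.
  split; rewrite ?oNk //; first by lia.
  by rewrite plus_odd half_Nk qpochD -Q1; move=> _; ring.
rewrite add0n in ek; rewrite ek in plus_even; have {}plus_even := plus_even Ik.
have oNk : odd (N + k) = odd N by rewrite oddD ok addbF.
have half_Nk : ((N + k)./2 = N./2 + k./2)%N by lia.
case oN: (odd N) oNk Qodd Qeven => /= oNk Qodd Qeven.
  split; rewrite ?oNk //; first by lia.
  have minus0 : minus_sum y I N = 0 by rewrite /minus_sum oN.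
  rewrite plus_even half_Nk qpochD -Qodd // minus0 => _.
  by case: (k./2) => [|b]; ring.
have [Q1 Q2] := Qeven isT.
case eb: k./2 => [|b].
  have -> : k = 0%N by lia.
  by rewrite !addn0 qpoch0 mulr1; split=> //; rewrite oN.
have minus_even := minus_sum_block_even y_generic I_N (b := b) (negbT oN).
rewrite -eb ek in minus_even; have {}minus_even := minus_even Ik.
rewrite eb in plus_even minus_even half_Nk *.
split; rewrite ?oNk //; first by lia.
move=> _; rewrite half_Nk plus_even minus_even eqn_add2r Q2.
case: eqP => [eq_mt|ne_mt].
  rewrite Q2 eq_mt eqxx !mulr0 !addr0 in Q1 *; split=> //.
  by rewrite -eq_mt in Q1 *; rewrite qpochD -Q1; ring.
case ea: N./2 ne_mt => [|a] ne_mt; first by move: le_mt; lia.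
have := Q2; rewrite ea; case: eqP => // _ {}Q2.
rewrite Q2 ea in Q1; rewrite qpochD -Q1.
have E1 := qbinSS y_generic a b; have E2 := qbinSS' y_generic a b.
have Y1 : y ^+ (2 * b.+1) = y ^+ b.+1 * y ^+ b.+1 by rewrite mul2n -addnn exprD.
have Y2 : y ^+ (2 * a.+1) = y ^+ a.+1 * y ^+ a.+1 by rewrite mul2n -addnn exprD.
rewrite Y1 in E1; rewrite Y2 in E2.
(* The first identity follows on eliminating [qbin y a.+1 b] by [E1]. For the second, [E2] reduces
   the new [plus_sum] to [qbin y a b.+1] times the old one. *)
rewrite /= exprD; split.
  have -> : qbin y a.+1 b = qbin y a.+1 b.+1 - y ^+ b.+1 * y ^+ b.+1 * qbin y a b.+1.
    by rewrite E1; ring.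
  by ring.
by rewrite E2; ring.
Qed.

(** A singleton is a block of size 1, whose half is 0, so [mt] and [D] do not change. *)
Lemma closed_form_singletons N n mt D : (N <= n)%N ->
  (forall j, (N <= j.+1 < n)%N -> ~~ I j) ->
  closed_form N mt D -> closed_form n mt D.
Proof.
move=> /subnKC <-; elim: (n - N)%N => [|k IHk] I_N QN; first by rewrite addn0.
have /IHk-/(_ QN) QNk : forall j, (N <= j.+1 < N + k)%N -> ~~ I j.
  by move=> j ?; apply: I_N; lia.
have := @closed_form_block (N + k) 1 mt D.
rewrite addn1 addn0 qpoch0 mulr1 -addnS; apply=> //.
  by move=> Nk_gt0; apply: I_N; lia.
by move=> j ? ?; lia.
Qed.

Definition half_sizes (cs : seq (nat * nat)) :=
  [seq (interval_card c + 1)./2 | c <- cs].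

(** Induction on the last component [(a, b)]: the letters below [a] come first, then the block from
    [a] to [b.+1], then singletons up to [n]. *)
Lemma closed_form_components cs n :
  sorted (fun c d : nat * nat => (c.2.+1 < d.1)%N) cs ->
  (forall c, c \in cs -> (c.1 <= c.2)%N) ->
  (forall c, c \in cs -> (c.2.+1 < n)%N) ->
  (forall j, (j.+1 < n)%N -> I j = has (fun c => c.1 <= j <= c.2)%N cs) ->
  closed_form n (\sum_(p <- half_sizes cs) p)
    (\prod_(p <- half_sizes cs) qpoch y p).
Proof.
elim/last_ind: cs n => [|cs [a b] IHcs] n cs_sorted cs_le cs_lt I_cs.
  rewrite /half_sizes !big_nil; apply: (@closed_form_singletons 0) => //.
    by move=> j ltjn; rewrite I_cs.
  split=> //= _; rewrite /plus_sum /minus_sum /= mulr0 addr0 qpoch0 mulr1.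
  by [].
have leab : (a <= b)%N by apply: (cs_le (a, b)); rewrite mem_rcons mem_head.
have ltbn : (b.+1 < n)%N by apply: (cs_lt (a, b)); rewrite mem_rcons mem_head.
have sub_cs c : c \in cs -> c \in rcons cs (a, b).
  by rewrite mem_rcons in_cons orbC => ->.
have cs_lt_a c : c \in cs -> (c.2.+1 < a)%N.
  move: cs_sorted; case: cs {IHcs cs_lt I_cs} cs_le sub_cs => [//|c0 cs] cs_le _ /=.
  rewrite rcons_path => /andP[cs_path lt_last].
  elim: cs c0 c cs_le cs_path lt_last => [|c1 cs IHcs] c0 c cs_le /=.
    by move=> _ lt_last; rewrite inE => /eqP->.
  case/andP=> lt01 cs_path lt_last; rewrite inE => /orP[/eqP->|]; last first.
    by apply: (IHcs c1) => // d Hd; apply: cs_le; rewrite inE Hd orbT.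
  have := IHcs c1 c1 _ cs_path lt_last (mem_head _ _).
  have := cs_le c1; rewrite !inE eqxx orbT => /(_ isT) le1 H.
  apply: ltn_trans lt01 (leq_ltn_trans le1 (ltnW (H _))).
  by move=> d Hd; apply: cs_le; rewrite inE Hd orbT.
have no_cs j : (a <= j.+1)%N -> has (fun c => c.1 <= j <= c.2)%N cs = false.
  move=> leaj; apply/negP => /hasP[c /cs_lt_a ltca /andP[_ lejc]].
  by have := leq_trans ltca leaj; rewrite ltnS ltnNge lejc.
have Qa : closed_form a (\sum_(p <- half_sizes cs) p)
                     (\prod_(p <- half_sizes cs) qpoch y p).
  apply: IHcs => //.
  - by move: cs_sorted; rewrite -cats1 => /cat_sorted2[].
  - by move=> c /sub_cs/cs_le.
  - move=> j ltja; rewrite I_cs; last lia.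
    by rewrite has_rcons /= leqNgt (ltn_trans _ ltja).
apply: (@closed_form_singletons b.+2) => //.
  move=> j ltj; rewrite I_cs; last lia.
  by rewrite has_rcons /= no_cs; lia.
rewrite /half_sizes map_rcons -cats1 !big_cat !big_seq1 /=.
have -> : (b.+2 = a + (interval_card (a, b) + 1))%N.
  by rewrite /interval_card /=; lia.
apply: closed_form_block Qa.
  by move=> a_gt0; rewrite I_cs ?has_rcons ?no_cs /=; lia.
move=> j leaj; rewrite /interval_card /= => ltj.
by rewrite I_cs ?has_rcons /=; lia.
Qed.

End ClosedForm.

(** * From permutations to words *)

(** A permutation is determined by the image [p] of the last index and the pattern [s] of the rest;
    injectivity and equal cardinalities give the bijection. *)
Lemma sum_lift_perm (R : nmodType) n (P : pred 'S_n.+1) (f : 'S_n.+1 -> R) :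
  \sum_(s : 'S_n.+1 | P s) f s
    = \sum_(p < n.+1) \sum_(s : 'S_n | P (lift_perm ord_max p s))
        f (lift_perm ord_max p s).
Proof.
rewrite pair_big_dep /=.
rewrite (reindex (fun ps : 'I_n.+1 * 'S_n => lift_perm ord_max ps.1 ps.2)) //=.
apply: onW_bij; apply: inj_card_bij => [[p s] [p' s'] /= eq_ps|]; last first.
  by rewrite card_prod !card_Sn card_ord factS.
have eq_p : p = p' by rewrite -(lift_perm_id ord_max p s) eq_ps lift_perm_id.
rewrite eq_p in eq_ps *; congr pair; apply/permP => i.
by apply: (@lift_inj _ p'); rewrite -!(lift_perm_lift ord_max) eq_ps.
Qed.

Definition inversions (P : rel nat) n (s : 'S_n) : nat :=
  \sum_(i < n) \sum_(j < n) [&& (i < j)%N, (s j < s i)%N & P i j].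

Lemma card_set_pairs (T : finType) (Q : T -> T -> bool) :
  #|[set p | Q p.1 p.2]| = (\sum_i \sum_j Q i j)%N.
Proof.
rewrite cardsE -sum1_card big_mkcond pair_bigA /=.
by apply: eq_bigr => p _; rewrite unfold_in /=; case: (Q _ _).
Qed.

Lemma ell_inversions n (s : 'S_n) : ell s = inversions (fun _ _ => true) s.
Proof.
rewrite /ell (card_set_pairs (fun i j : 'I_n => (i < j)%N && (s j < s i)%N)).
by apply: eq_bigr => i _; apply: eq_bigr => j _; rewrite andbT.
Qed.

Lemma odd_length_inversions n (s : 'S_n) :
  odd_length s = inversions (fun i j => odd i != odd j) s.
Proof.
rewrite /odd_length (card_set_pairs
  (fun i j : 'I_n => [&& (i < j)%N, (s j < s i)%N & i != j %[mod 2]])).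
apply: eq_bigr => i _; apply: eq_bigr => j _.
by rewrite !modn2; case: (odd i); case: (odd j).
Qed.

(** The last index is only ever the larger member of an inversion, and its image [p] is below
    [bump p (s i)] exactly when [p <= s i]. *)
Lemma inversions_lift_perm (P : rel nat) n (p : 'I_n.+1) (s : 'S_n) :
  inversions P (lift_perm ord_max p s)
    = (inversions P s + \sum_(i < n) ((p <= s i) && P i n))%N.
Proof.
have Elift (i : 'I_n) : widen_ord (leqnSn n) i = lift ord_max i.
  by apply: val_inj; rewrite [RHS]lift_max.
rewrite /inversions big_ord_recr /= [X in (_ + X)%N]big1 => [|j _]; last first.
  by rewrite ltnNge -ltnS ltn_ord.
rewrite addn0 -big_split /=; apply: eq_bigr => i _.
rewrite big_ord_recr /= ltn_ord /=; congr (_ + nat_of_bool _)%N; last first.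
  rewrite Elift lift_perm_id lift_perm_lift /= /bump; congr (_ && _).
  by case: (leqP p (s i)) => [|/ltnW ltsp]; rewrite ?ltnS // ltnNge ltsp.
apply: eq_bigr => j _; rewrite !Elift !lift_perm_lift /= /bump.
congr (nat_of_bool [&& _, _ & _]).
by rewrite !ltnNge leq_bump2.
Qed.

Section WordSumPerm.

Variables (F : fieldType) (y : F) (I : nat -> bool).

(** The last condition is quantified so as to be void for [n = 0]. *)
Definition admissible n (e : nat -> bool) u (s : 'S_n) : bool :=
  [&& [forall i, e (s i) == odd i],
      [forall i : 'I_n, forall j : 'I_n, (j == i.+1 :> nat) && I i ==> (s i < s j)%N]
    & [forall i : 'I_n, (i.+1 == n) ==> (s i < u)%N]].

Lemma forall_ord_recr n (P : pred 'I_n.+1) :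
  [forall i, P i] = [forall i, P (lift ord_max i)] && P ord_max.
Proof.
apply/forallP/andP => [H|[/forallP H Hm] i].
  by split=> //; apply/forallP.
by case: (unliftP ord_max i) => [j|] ->.
Qed.

Lemma admissible_lift_perm n e u (p : 'I_n.+1) (s : 'S_n) :
  admissible e u (lift_perm ord_max p s)
    = [&& (p < u)%N, e p == odd n
        & admissible (e \o bump p) (if I n.-1 then p : nat else n) s].
Proof.
rewrite /admissible !forall_ord_recr /= !lift_perm_id eqxx /=.
have -> : [forall i, e (lift_perm ord_max p s (lift ord_max i)) == odd (lift ord_max i)]
        = [forall i, e (bump p (s i)) == odd i].
  by apply: eq_forallb => i; rewrite lift_perm_lift lift_max.
have -> : [forall i : 'I_n, ((lift ord_max i).+1 == n.+1)
              ==> (lift_perm ord_max p s (lift ord_max i) < u)%N] = true.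
  by apply/forallP => i; rewrite lift_max eqSS ltn_eqF.
have bump_n (i : 'I_n) : bump n i = i := lift_max i.
have -> : [forall i : 'I_n, (bump n i == n.+1) && I n
              ==> (p < lift_perm ord_max p s (lift ord_max i))%N] = true.
  by apply/forallP => i; rewrite bump_n ltn_eqF ?ltnS ?(ltnW (ltn_ord i)).
rewrite (ltn_eqF (ltnSn n)) /= !andbT.
have -> : [forall i : 'I_n, [forall j : 'I_n.+1,
            (j == (bump n i).+1 :> nat) && I (bump n i) ==>
            (lift_perm ord_max p s (lift ord_max i) < lift_perm ord_max p s j)%N]]
   = [forall i : 'I_n, forall j : 'I_n, (j == i.+1 :> nat) && I i ==> (s i < s j)%N]
     && [forall i : 'I_n, (i.+1 == n) ==> (s i < if I n.-1 then p : nat else n)%N].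
  have -> : forall A B : pred 'I_n,
      [forall i, A i] && [forall i, B i] = [forall i, A i && B i].
    move=> A B; apply/andP/forallP => [[/forallP HA /forallP HB] i|H].
      by rewrite HA HB.
    by split; apply/forallP => i; have /andP[] := H i.
  apply: eq_forallb => i; rewrite forall_ord_recr lift_perm_id lift_perm_lift bump_n.
  congr (_ && _).
    apply: eq_forallb => j; rewrite lift_perm_lift lift_max /= /bump.
    by rewrite !ltnNge leq_bump2.
  rewrite /= eq_sym; case: eqP => //= Ei; rewrite (_ : n.-1 = i); last lia.
  case: (I i) => /=; last by rewrite ltn_ord.
  by rewrite /bump; case: (leqP p (s i)) => lep; lia.
by rewrite -andbA andbC -!andbA; do 3!bool_congr; rewrite andbC -!andbA.
Qed.

Lemma word_sum_perm n e u :
  word_sum y I n e u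
    = \sum_(s : 'S_n | admissible e u s) (-1) ^+ ell s * y ^+ odd_length s.
Proof.
elim: n e u => [|n IHn] e u.
  rewrite (bigD1 1%g) /=; last by apply/and3P; split; apply/forallP => -[].
  rewrite big1 => [|s /andP[_ /eqP[]]]; last by apply/permP => -[].
  by rewrite ell_inversions odd_length_inversions /inversions !big_ord0 addr0 mulr1.
rewrite sum_lift_perm word_sumS.
rewrite (big_nat_widen _ _ (u + n.+1)) ?leq_addr //.
have -> : \sum_(0 <= p < u + n.+1 | (p <= n)%N && (e p == odd n) && (p < u)%N)
            word_term y I n e p
        = \sum_(p < n.+1 | (p < u)%N && (e p == odd n)) word_term y I n e p.
  rewrite -(big_mkord (fun p => (p < u)%N && (e p == odd n))).
  rewrite [RHS](big_nat_widen _ _ (u + n.+1)) ?leq_addl //.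
  by apply: eq_bigl => p; rewrite ltnS andbC (andbC (p <= n)%N) andbA.
rewrite big_mkcond; apply: eq_bigr => p _.
under [RHS]eq_bigl => s do rewrite admissible_lift_perm andbA.
case: ifP => _ /=; last by rewrite big_pred0.
rewrite /word_term IHn mulr_sumr; apply: eq_bigr => s /andP[/forallP Hs _].
rewrite !ell_inversions !odd_length_inversions !inversions_lift_perm !exprD.
have sum_perm (f : nat -> nat) :
    (forall j, (j < p)%N -> f j = 0%N) ->
    (\sum_(i < n) f (s i) = \sum_(p <= j < n) f j)%N.
  move=> f0; transitivity (\sum_(i < n) f i)%N.
    by rewrite [RHS](reindex_inj (@perm_inj _ s)).
  rewrite -(big_mkord xpredT f) (big_cat_nat (n := p)) //=;
    last by rewrite -ltnS ltn_ord.
  by rewrite big_nat_cond big1 // => j; rewrite andbT => /f0.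
have -> : (\sum_(i < n) ((p <= s i)%N && true) = n - p)%N.
  rewrite (sum_perm (fun j => (p <= j)%N && true : nat)) => [|j]; last first.
    by rewrite ltnNge => /negPf->.
  rewrite (eq_big_nat _ _ (F2 := fun=> 1%N)) => [|i /andP[-> _] //].
  by rewrite sum_nat_const_nat muln1.
(* Admissibility turns the parity of the letter [i] into a function of its position, after which the
   sum is reindexed by [s]. *)
have -> : (\sum_(i < n) ((p <= s i) && (odd i != odd n))
         = \sum_(p <= j < n) (e (bump p j) != odd n))%N.
  transitivity (\sum_(i < n) ((p <= s i)%N && (e (bump p (s i)) != odd n)))%N.
    by apply: eq_bigr => i _; rewrite -(eqP (Hs i)).
  rewrite (sum_perm (fun j => (p <= j)%N && (e (bump p j) != odd n) : nat)) => [|j].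
    by apply: eq_big_nat => i /andP[-> _].
  by rewrite ltnNge => /negPf->.
by ring.
Qed.

End WordSumPerm.

(** * The chessboard sum *)

(** The powers of [1 - y ^+ 2] cancel because the parts add up to the top index. *)
Lemma qmultinomial_qpoch (F : fieldType) (y : F) parts :
  (forall k, (0 < k)%N -> 1 - y ^+ (2 * k) != 0) ->
  qmultinomial (y ^+ 2) (\sum_(p <- parts) p) parts
    = qpoch y (\sum_(p <- parts) p) / \prod_(p <- parts) qpoch y p.
Proof.
move=> y_generic.
have q_neq0 : 1 - y ^+ 2 != 0 := y_generic 1%N isT.
have qfactE r : qfact (y ^+ 2) r = qpoch y r / (1 - y ^+ 2) ^+ r.
  elim: r => [|r IHr]; first by rewrite /qfact big_geq // qpoch0 divr1.
  rewrite /qfact big_nat_recr //= -/(qfact _ r) IHr qpochS /qint -exprM (exprS (1 - _)).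
  by rewrite invfM; ring.
rewrite /qmultinomial qfactE (eq_bigr _ (fun p _ => qfactE p)).
have -> : \prod_(p <- parts) (qpoch y p / (1 - y ^+ 2) ^+ p)
    = (\prod_(p <- parts) qpoch y p) / (1 - y ^+ 2) ^+ (\sum_(p <- parts) p).
  elim: parts => [|p parts IHparts]; first by rewrite !big_nil divr1.
  by rewrite !big_cons IHparts exprD invfM; ring.
by rewrite invf_div mulrA divfK // expf_neq0.
Qed.

Lemma x_generic k : (0 < k)%N -> 1 - x ^+ (2 * k) != 0.
Proof.
move=> k_gt0; rewrite /x -rmorphXn -(rmorph1 (FracField.tofrac (R := {poly int}))).
rewrite -rmorphB tofrac_eq0 subr_eq0; apply/eqP => /(congr1 (size \o val)).
by rewrite /= size_poly1 size_polyXn; lia.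
Qed.

Section Chessboard.

Variables (n : nat) (I : {set 'I_n.-1}).

Definition ascents (k : nat) : bool := [exists i in I, k == i :> nat].

Lemma ascentsP (k : nat) :
  reflect (exists2 i : 'I_n.-1, i \in I & k = i) (ascents k).
Proof.
apply: (iffP exists_inP) => -[i Ii]; first by move/eqP->; exists i.
by move=> ->; exists i.
Qed.

Lemma admissible_quotient c (s : 'S_n) :
  admissible ascents (alt c) n s
    = [forall i : 'I_n, (i + s i == c %[mod 2])%N] && (s \in quotient_set I).
Proof.
rewrite /admissible; congr (_ && _).
  apply: eq_forallb => i; rewrite !modn2 oddD /alt oddb.
  by case: c; case: (odd i); case: (odd (s i)).
have -> : [forall i : 'I_n, (i.+1 == n) ==> (s i < n)%N].
  by apply/forallP => i; rewrite ltn_ord implybT.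
rewrite andbT inE; apply/idP/idP => [/forallP H|/forall_inP H].
  apply/forall_inP => i Ii; apply/forallP => a; apply/forallP => b.
  apply/implyP => /andP[/eqP ea /eqP eb]; have /forallP/(_ b)/implyP := H a.
  by apply; rewrite eb ea eqxx; apply/ascentsP; exists i.
apply/forallP => a; apply/forallP => b.
apply/implyP => /andP[/eqP eb /ascentsP[i Ii ea]].
have /forallP/(_ a)/forallP/(_ b)/implyP := H i Ii.
by apply; rewrite eb ea !eqxx.
Qed.

(** Exactly one of [i] and [s i] would be odd for every [i], so [n] would be twice the number of odd
    indices. *)
Lemma chessboard_odd_empty (s : 'S_n) : odd n -> s \notin chessboard_odd n.
Proof.
move=> odd_n; rewrite inE; apply/negP => /forallP Hs.
have : (\sum_(i < n) odd i + \sum_(i < n) odd (s i) = n)%N.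
  rewrite -big_split /= -[RHS]card_ord -sum1_card; apply: eq_bigr => i _.
  by have := Hs i; rewrite !modn2 oddD; case: (odd i); case: (odd (s i)).
have -> : (\sum_(i < n) odd (s i) = \sum_(i < n) odd i)%N.
  by rewrite [RHS](reindex_inj (@perm_inj _ s)).
by move: odd_n => /[swap] <-; rewrite addnn odd_double.
Qed.

Lemma chessboard_sum_word_sum : (0 < n)%N ->
  chessboard_sum I = plus_sum x ascents n - minus_sum x ascents n.
Proof.
move=> n_gt0; rewrite /chessboard_sum.
(* Position 0 separates the two sets; for [n = 0] they would coincide. *)
have disj (s : 'S_n) : s \in chessboard_odd n -> s \notin chessboard_even n.
  rewrite !inE => /forallP H; apply/negP => /forallP H'.
  by move: (H (Ordinal n_gt0)) (H' (Ordinal n_gt0)); rewrite !modn2; case: (odd _).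
rewrite (bigID (mem (chessboard_even n))) /=; congr (_ + _).
  rewrite /plus_sum word_sum_perm; apply: eq_big => s.
    rewrite admissible_quotient !in_setI !in_setU andbC !inE.
    by case: [forall i, _].
  by rewrite /chi => /andP[_ ->]; rewrite mulr1.
transitivity (- \sum_(s : 'S_n | (s \in chessboard_odd n) && (s \in quotient_set I))
                  (-1) ^+ ell s * x ^+ odd_length s).
  rewrite -sumrN; apply: eq_big => [s|s /andP[_ /negPf ne]]; last first.
    by rewrite /chi ne rmorphN1 mulrN1 mulNr.
  rewrite in_setI in_setU; have := disj s.
  by case: (s \in chessboard_odd n) => [/(_ isT)/negPf->|_];
     case: (s \in chessboard_even n); rewrite ?andbT ?andbF.
rewrite /minus_sum eqn0Ngt n_gt0 orbF; congr (- _); case: ifP => [odd_n|_].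
  by rewrite big1 // => s /andP[]; rewrite (negPf (chessboard_odd_empty s odd_n)).
by rewrite word_sum_perm; apply: eq_bigl => s; rewrite admissible_quotient inE.
Qed.

End Chessboard.

Theorem theorem4p2 (n : nat) (hn : (0 < n)%N) (I : {set 'I_n.-1})
    (cs : seq (nat * nat)) (hcs : connected_components I cs) :
  let m := n./2 in
  let parts := [seq (interval_card c + 1)./2 | c <- cs] in
  let mt := (\sum_(p <- parts) p)%N in
  let multinom := qmultinomial (x ^+ 2) mt parts in
  (n = (2 * m + 1)%N ->
     chessboard_sum I = multinom * \prod_(mt.+1 <= k < m.+1) (1 - x ^+ (2 * k)))
  /\
  (n = (2 * m)%N ->
     chessboard_sum I =
       if m == mt then multinom
       else (1 + x ^+ m) * multinom
              * \prod_(mt.+1 <= k < m) (1 - x ^+ (2 * k))).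
Proof.
move=> m parts mt multinom; have [cs_I cs_le cs_sorted] := hcs.
have cs_lt c : c \in cs -> (c.2.+1 < n)%N.
  move=> cs_c; have [|i _ ->] := (cs_I c.2).2; last by have := ltn_ord i; lia.
  by exists c => //; rewrite leqnn andbT cs_le.
have I_cs j : (j.+1 < n)%N ->
    ascents I j = has (fun c => c.1 <= j <= c.2)%N cs.
  by move=> _; apply/ascentsP/hasP => /cs_I.
have [le_mt Qodd Qeven] := closed_form_components x_generic cs_sorted cs_le cs_lt I_cs.
rewrite -/m -/parts -/mt -/(half_sizes cs) in le_mt Qodd Qeven.
set D := \prod_(p <- _) _ in Qodd Qeven.
have D_neq0 : D != 0.
  by rewrite prodf_seq_neq0; apply/allP => p _; apply: qpoch_neq0 x_generic _.
have multinomE : multinom = qpoch x mt / D by apply: qmultinomial_qpoch x_generic.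
have qpoch_cat r : (mt <= r)%N ->
    qpoch x r = qpoch x mt * \prod_(mt.+1 <= k < r.+1) (1 - x ^+ (2 * k)).
  by move=> le_r; rewrite /qpoch -big_cat_nat.
rewrite chessboard_sum_word_sum //; split=> en.
  have odd_n : odd n by rewrite en; lia.
  rewrite /minus_sum odd_n subr0 multinomE mulrAC -qpoch_cat // -Qodd //.
  by rewrite mulrC mulKf.
have even_n : ~~ odd n by rewrite en; lia.
have [Q1 Q2] := Qeven even_n; rewrite Q2; case: eqP => [eq_m|/eqP ne_m].
  rewrite Q2 eq_m eqxx mulr0 addr0 in Q1.
  by rewrite subr0 multinomE -Q1 mulrC mulKf.
rewrite (negPf ne_m) in Q2; rewrite Q2 in Q1.
have lt_mt : (mt < m)%N by rewrite ltn_neqAle eq_sym ne_m.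
have m_gt0 : (0 < m)%N by apply: leq_ltn_trans lt_mt.
(* By [Q2], the left side of [Q1] contains [1 - x ^+ (2 * m)], the last factor of [qpoch x m], which
   cancels. *)
have E : D * plus_sum x (ascents I) n = qpoch x m.-1.
  apply: (mulIf (x_generic m_gt0)).
  have := qpochS x m.-1; rewrite prednK // => <-; rewrite -Q1.
  by rewrite mul2n -addnn exprD; ring.
have le_mt' : (mt <= m.-1)%N by rewrite -ltnS prednK.
have := qpoch_cat _ le_mt'; rewrite prednK // => E'.
have -> : plus_sum x (ascents I) n
    = multinom * \prod_(mt.+1 <= k < m) (1 - x ^+ (2 * k)).
  by rewrite multinomE mulrAC -E' -E mulrC mulKf.
by ring.
Qed.
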